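(* Let $m,r$ be integers with $m\ge1$, $r<m-1$ and $r\ge\lceil\frac{m-1}{2}\rceil$. Then the basis codewords $|\mathbf w\rangle^*_{r,m}$ of $\mathrm{pQRM}(r,m)$ on $2^m-1$ qubits can be written as a superposition of tensor products of codewords of $\mathrm{pQRM}(r,m-1)$ on the first $2^{m-1}-1$ qubits and of $\mathrm{QRM}(r,m-1)$ on the last $2^{m-1}$ qubits. Explicitly, for $\mathbf w=(\mathbf w_1,\mathbf w_2)\in\mathrm{pRM}(r,m)$ with $\mathbf w_1\in\mathrm{pRM}(r,m-1)$ and $\mathbf w_2\in\mathrm{RM}(r,m-1)$, $$|\mathbf w\rangle_{r,m}^*=\frac{1}{\sqrt{|B|}}\sum_{\mathbf u\in B}|\mathbf w_1\oplus\mathbf u^*\rangle_{r,m-1}^*\otimes|\mathbf w_2\oplus\mathbf u\rangle_{r,m-1},$$ where $B=\mathrm{RM}(r-1,m-1)^\perp/\mathrm{RM}(r,m-1)^\perp$ is a quotient set; the sum runs over one representative $\mathbf u$ of each coset, the representatives being chosen in the $\mathbb F_2$-span of the evaluation vectors of the monomials of degree exactly $m-r-1$ in $m-1$ variables.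
   Context: For $0\le r\le m$, $\mathrm{RM}(r,m)\subseteq\mathbb F_2^{2^m}$ is the binary Reed-Muller code: the set of evaluation vectors $\mathrm{Eval}^{(m)}(f)=(f(\boldsymbol\rho(1)),\dots,f(\boldsymbol\rho(2^m)))$ of polynomials $f\in\mathbb F_2[x_1,\dots,x_m]$ of degree at most $r$, where $\boldsymbol\rho(j)\in\mathbb F_2^m$ is the $m$-bit binary representation of $j-1$ (first coordinate most significant; $\boldsymbol\rho(1)=\mathbf 0$). Set $\mathrm{RM}(s,m)=\{\mathbf 0\}$ for $s<0$. One has $\mathrm{RM}(r,m)^\perp=\mathrm{RM}(m-r-1,m)$. For a vector $\mathbf c$, $\mathbf c^*$ denotes $\mathbf c$ with its first coordinate deleted, and $\mathrm{pRM}(r,m)=\{\mathbf c^*:\mathbf c\in\mathrm{RM}(r,m)\}\subseteq\mathbb F_2^{2^m-1}$ for $r\le m-1$. Its dual $\mathrm{pRM}(r,m)^\perp$ is the span of the punctured evaluation vectors of monomials of degree between $1$ and $m-r-1$, i.e. $\{\mathbf c^*:\mathbf c\in\mathrm{RM}(m-r-1,m),\ c_1=0\}$ (written $\mathrm{pRM}(m-r-1,m)/\{\mathbf 1\}$). For $r\ge (m-1)/2$: $\mathrm{QRM}(r,m)$ is the code on $2^m$ qubits spanned by $|\mathbf w\rangle_{r,m}=|\mathrm{RM}(r,m)^\perp|^{-1/2}\sum_{\mathbf c\in \mathrm{RM}(r,m)^\perp}|\mathbf w\oplus\mathbf c\rangle$, $\mathbf w\in\mathrm{RM}(r,m)$;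 and $\mathrm{pQRM}(r,m)$ (with $r\le m-1$) is the code on $2^m-1$ qubits spanned by $|\mathbf w\rangle^*_{r,m}=|\mathrm{pRM}(r,m)^\perp|^{-1/2}\sum_{\mathbf c\in \mathrm{pRM}(r,m)^\perp}|\mathbf w\oplus\mathbf c\rangle$, $\mathbf w\in\mathrm{pRM}(r,m)$. *)

(* Defs.v *)
(* MathComp world, with multinomials for F_2[x_1, ..., x_m]; [boolp] is used only to
   turn the existential over polynomials in [RM] into a boolean. *)
From HB Require Import structures.
From mathcomp Require Import all_boot all_order all_algebra.
From mathcomp Require Import boolp mpoly.

Set Implicit Arguments.
Unset Strict Implicit.
Unset Printing Implicit Defensive.

Import Order.TTheory GRing.Theory Num.Theory.
Local Open Scope ring_scope.

(** * Classical codes *)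

(* [j] counts from 0 and variables are numbered from 0, so variable [i] carries
   the bit of weight 2 ^ (m - 1 - i): variable 0 is the most significant bit. *)
Definition bitpoint (m : nat) (j : 'I_(2 ^ m)) (i : 'I_m) : 'F_2 :=
  (odd (j %/ 2 ^ (m - i.+1)))%:R.

Definition Eval (m : nat) (f : {mpoly 'F_2[m]}) : 'rV['F_2]_(2 ^ m) :=
  \row_(j < 2 ^ m) f.@[bitpoint j].

(* In multinomials, [msize f] is the total degree plus one, and [msize 0] is 0. *)
Definition RM (s : int) (m : nat) : {set 'rV['F_2]_(2 ^ m)} :=
  if s is Posz r then
    [set c | `[< exists2 f : {mpoly 'F_2[m]}, (msize f <= r.+1)%N & c = Eval f >]]
  else [set 0].

Definition dual (n : nat) (K : {set 'rV['F_2]_n}) : {set 'rV['F_2]_n} :=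
  [set x : 'rV['F_2]_n | [forall c in K, \sum_(j < n) x 0 j * c 0 j == 0]].

Lemma exp2_gt0 (m : nat) : (0 < 2 ^ m)%N.
Proof. by rewrite expn_gt0. Qed.

Definition puncture (m : nat) (c : 'rV['F_2]_(2 ^ m)) : 'rV['F_2]_((2 ^ m).-1) :=
  col' (Ordinal (exp2_gt0 m)) c.

Definition pRM (s : int) (m : nat) : {set 'rV['F_2]_((2 ^ m).-1)} :=
  [set puncture c | c in RM s m].

Definition cosets (n : nat) (K D : {set 'rV['F_2]_n}) : {set {set 'rV['F_2]_n}} :=
  [set [set u + d | d in D] | u in K].

(* Since x^2 = x on F_2, a monomial function is a product of distinct variables;
   a repeated variable would let in functions of lower degree. *)
Definition monomial_span (d n : nat) : {vspace 'rV['F_2]_(2 ^ n)} :=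
  <<[seq Eval (\prod_(i in A) 'X_i) | A : {set 'I_n} in [pred A : {set 'I_n} | #|A| == d]]>>%VS.

(** * Quantum states *)

(* A (not necessarily normalized) state of [n] qubits is its family of amplitudes
   in the computational basis; [C] stands for the complex numbers. *)
Definition qstate (C : numClosedFieldType) (n : nat) :=
  {ffun 'rV['F_2]_n -> C^o}.

Definition ket (C : numClosedFieldType) (n : nat) (x : 'rV['F_2]_n) : qstate C n :=
  [ffun y => (y == x)%:R].

Definition tensor (C : numClosedFieldType) (n1 n2 : nat)
    (phi : qstate C n1) (psi : qstate C n2) : qstate C (n1 + n2) :=
  [ffun x => (phi (lsubmx x) : C) * (psi (rsubmx x) : C)].

Definition coset_state (C : numClosedFieldType) (n : nat)
    (D : {set 'rV['F_2]_n}) (w : 'rV['F_2]_n) : qstate C n :=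
  (sqrtC (#|D|%:R : C))^-1 *: \sum_(c in D) ket C (w + c).

Definition QRM_state (C : numClosedFieldType) (r : int) (m : nat)
    (w : 'rV['F_2]_(2 ^ m)) : qstate C (2 ^ m) :=
  coset_state C (dual (RM r m)) w.

Definition pQRM_state (C : numClosedFieldType) (r : int) (m : nat)
    (w : 'rV['F_2]_((2 ^ m).-1)) : qstate C (2 ^ m).-1 :=
  coset_state C (dual (pRM r m)) w.

Definition QRM (C : numClosedFieldType) (r : int) (m : nat) :
    {vspace qstate C (2 ^ m)} :=
  <<[seq QRM_state C r w | w in RM r m]>>%VS.

Definition pQRM (C : numClosedFieldType) (r : int) (m : nat) :
    {vspace qstate C (2 ^ m).-1} :=
  <<[seq pQRM_state C r w | w in pRM r m]>>%VS.

(** * Splitting the punctured positions into two halves *)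

Lemma split_length (m : nat) (hm : (1 <= m)%N) :
  ((2 ^ m.-1).-1 + 2 ^ m.-1 = (2 ^ m).-1)%N.
Proof.
case: m hm => // m _; rewrite expnS mul2n -addnn /=.
by case: (2 ^ m)%N (exp2_gt0 m).
Qed.

Definition cast_vec (n n' : nat) (e : n = n') (x : 'rV['F_2]_n) : 'rV['F_2]_n' :=
  castmx (erefl 1%N, e) x.

Definition cast_state (C : numClosedFieldType) (n n' : nat) (e : n = n')
    (phi : qstate C n) : qstate C n' :=
  [ffun x => phi (cast_vec (esym e) x)].

(* Main.v *)
(** Over F_2, the product of the monomial functions x_A and x_B is x_(A u B), and
the values of x_A on all of F_2^n add up to 1 if A is everything and to 0 otherwise.
Hence the monomials x_B with #|B| = n - r and x_A with #|A| = r are dual to each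
other up to complementation, while such x_B are orthogonal to RM(r - 1, n).  So a
vector k of K = RM(r - 1, n)^perp is congruent modulo D = RM(r, n)^perp to the
combination of the x_B with coefficients <k, x_(~B)>, which depends only on k + D.

With n = m - 1, restricting monomials to the two halves of F_2^m (Plotkin's
(a, a + b) construction) describes the dual of pRM(r, m): it consists of the
(x1, x2) with x2 in K such that (x1, x2) is orthogonal to (a^*, a) for every a in
RM(r, n).  Representatives u in the span of the x_B vanish at the origin, since
n - r > 0, so subtracting (u^*, u) for the representative u of x2 + D leaves x1 - u^*
in the dual of pRM(r, n).  Thus the dual of pRM(r, m) is the disjoint union of the
products (u^* + pRM(r, n)^perp) x (u + D), and the identity between states follows
by comparing amplitudes. *)
Require Import Defs.
From HB Require Import structures.
From mathcomp Require Import all_boot all_order all_algebra.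
From mathcomp Require Import boolp mpoly.
From mathcomp Require Import zify.

Set Implicit Arguments.
Unset Strict Implicit.
Unset Printing Implicit Defensive.

Import Order.TTheory GRing.Theory Num.Theory.
Local Open Scope ring_scope.

(** * Arithmetic of F_2 and induction over spans *)

Lemma F2_cases (a : 'F_2) : a = 0 \/ a = 1.
Proof.
by case: a => [[|[|]]] //= i; [left | right]; apply: val_inj.
Qed.

Lemma F2_opp (a : 'F_2) : - a = a.
Proof. by case: (F2_cases a) => ->; apply: val_inj. Qed.

Lemma span_ind (F : fieldType) (vT : vectType F) (s : seq vT) (P : vT -> Prop) :
  P 0 -> (forall a x y, P x -> P y -> P (a *: x + y)) ->
  (forall x, x \in s -> P x) -> forall v, v \in <<s>>%VS -> P v.
Proof.
move=> P0 PD Ps v /(@coord_span _ _ _ (in_tuple s)) ->.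
elim/big_rec: _ => // i y _ Py; apply: PD => //.
by apply: Ps; rewrite mem_nth.
Qed.

(** * Squarefree monomials as generators of Reed-Muller codes *)

(** The argument [k] is a plain number, so that the positions [j.+1] (puncturing) and [2 ^ n + j]
    (second half) need no ordinal casts. *)
Definition monv (m : nat) (A : {set 'I_m}) (k : nat) : 'F_2 :=
  \prod_(i in A) (odd (k %/ 2 ^ (m - i.+1)))%:R.

Definition Evalm (m : nat) (A : {set 'I_m}) : 'rV['F_2]_(2 ^ m) :=
  \row_(j < 2 ^ m) monv A j.

Lemma Eval_prodX m (A : {set 'I_m}) : Eval (\prod_(i in A) 'X_i) = Evalm A.
Proof.
apply/rowP => j; rewrite !mxE rmorph_prod; apply: eq_bigr => i _ /=.
by rewrite mevalXU.
Qed.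

(** Since x^k = x on F_2 for k > 0, only the support of the exponent matters. *)
Lemma Eval_mnm m (e : 'X_{1..m}) :
  Eval 'X_[e] = Evalm [set i | e i != 0%N].
Proof.
apply/rowP => j; rewrite !mxE mevalX /monv [RHS]big_mkcond.
apply: eq_bigr => i _ /=; rewrite inE /bitpoint.
case: (e i) => [|k] //=.
by case: (odd _); rewrite ?expr1n // expr0n.
Qed.

Lemma RM_E r m c : c \in RM (Posz r) m <->
  exists2 f : {mpoly 'F_2[m]}, (msize f <= r.+1)%N & c = Eval f.
Proof. by rewrite inE; split => /asboolP. Qed.

Lemma RM0 r m : 0 \in RM (Posz r) m.
Proof.
apply/RM_E; exists 0; first by rewrite mmeasure0.
by apply/rowP => j; rewrite !mxE meval0.
Qed.

Lemma RMD r m x y : x \in RM (Posz r) m -> y \in RM (Posz r) m ->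
  x + y \in RM (Posz r) m.
Proof.
move=> /RM_E [f hf ->] /RM_E [g hg ->]; apply/RM_E; exists (f + g).
  by apply: leq_trans (mmeasureD_le _ _ _) _; rewrite geq_max hf.
by apply/rowP => j; rewrite !mxE mevalD.
Qed.

Lemma RM_Evalm r m (A : {set 'I_m}) : (#|A| <= r)%N -> Evalm A \in RM (Posz r) m.
Proof.
move=> hA; apply/RM_E; exists 'X_[mesym1 A].
  by rewrite msizeX mdeg_mesym1.
rewrite Eval_mnm; congr Evalm; apply/setP => i.
by rewrite inE mnmE; case: (i \in A).
Qed.

(** Replacing an exponent by its support does not raise the degree, and a nonzero coefficient is 1,
    so closure under addition suffices. *)
Lemma RM_ind r m (P : 'rV['F_2]_(2 ^ m) -> Prop) :
  P 0 -> (forall x y, P x -> P y -> P (x + y)) ->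
  (forall A : {set 'I_m}, (#|A| <= r)%N -> P (Evalm A)) ->
  forall c, c \in RM (Posz r) m -> P c.
Proof.
move=> P0 PD PA c /RM_E [f hf ->].
have -> : Eval f = \sum_(e <- msupp f) f@_e *: Eval 'X_[e].
  apply/rowP => j; rewrite mxE mevalE summxE; apply: eq_bigr => e _.
  by rewrite !mxE mevalX.
rewrite big_seq; elim/big_rec: _ => // e y he Py; apply: (PD _ _ _ Py).
case: (F2_cases f@_e) => ->; first by rewrite scale0r.
rewrite scale1r Eval_mnm; apply: PA.
apply: leq_trans (_ : mdeg e <= r)%N; last first.
  by rewrite -ltnS; apply: leq_trans hf; apply: msize_mdeg_lt.
rewrite mdegE -sum1_card big_mkcond; apply: leq_sum => i _.
by rewrite inE; case: (e i).
Qed.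

Lemma RM_mono r s m : (r <= s)%N -> {subset RM (Posz r) m <= RM (Posz s) m}.
Proof.
by move=> rs c /RM_E [f hf ->]; apply/RM_E; exists f => //; apply: leq_trans hf _.
Qed.

(** * Dual codes, tested on monomials *)

Lemma dualP n (K : {set 'rV['F_2]_n}) (x : 'rV_n) :
  reflect (forall c, c \in K -> \sum_(j < n) x 0 j * c 0 j = 0) (x \in dual K).
Proof.
by rewrite inE; apply: (iffP forall_inP) => h c /h /eqP.
Qed.

Lemma dual0 n (K : {set 'rV['F_2]_n}) : 0 \in dual K.
Proof. by apply/dualP => c _; rewrite big1 // => j _; rewrite mxE mul0r. Qed.

Lemma dualB n (K : {set 'rV['F_2]_n}) x y :
  x \in dual K -> y \in dual K -> x - y \in dual K.
Proof.
move=> /dualP hx /dualP hy; apply/dualP => c hc.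
under eq_bigr do rewrite !mxE mulrBl.
by rewrite sumrB hx // hy // subr0.
Qed.

Lemma dualS n (K L : {set 'rV['F_2]_n}) : K \subset L -> dual L \subset dual K.
Proof.
by move=> /subsetP KL; apply/subsetP => x /dualP h; apply/dualP => c /KL /h.
Qed.

Lemma dual_RM r m (x : 'rV_(2 ^ m)) : x \in dual (RM (Posz r) m) <->
  forall A : {set 'I_m}, (#|A| <= r)%N -> \sum_(j < 2 ^ m) x 0 j * monv A j = 0.
Proof.
split=> [/dualP h A hA | h].
  by rewrite -[RHS](h _ (RM_Evalm hA)); apply: eq_bigr => j _; rewrite mxE.
apply/dualP; apply: RM_ind => [|c d hc hd|A hA].
- by rewrite big1 // => j _; rewrite mxE mulr0.
- by under eq_bigr do rewrite mxE mulrDr; rewrite big_split /= hc hd addr0.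
- by rewrite -[RHS](h A hA); apply: eq_bigr => j _; rewrite mxE.
Qed.

(** Puncturing removes position 0, so entry [j] of a punctured vector belongs to the point numbered
    [j.+1]. *)
Lemma dual_pRM r m (x : 'rV_((2 ^ m).-1)) : x \in dual (pRM (Posz r) m) <->
  forall A : {set 'I_m}, (#|A| <= r)%N ->
    \sum_(j < (2 ^ m).-1) x 0 j * monv A j.+1 = 0.
Proof.
split=> [/dualP h A hA | h].
  rewrite -[RHS](h (puncture (Evalm A))); last by apply: imset_f; apply: RM_Evalm.
  by apply: eq_bigr => j _; rewrite !mxE.
apply/dualP => _ /imsetP [c hc ->].
have -> : \sum_j x 0 j * puncture c 0 j =
          \sum_j x 0 j * c 0 (lift (Ordinal (exp2_gt0 m)) j).
  by apply: eq_bigr => j _; rewrite mxE.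
move: c hc; apply: RM_ind => [|c d hc hd|A hA].
- by rewrite big1 // => j _; rewrite mxE mulr0.
- by under eq_bigr do rewrite mxE mulrDr; rewrite big_split /= hc hd addr0.
- by rewrite -[RHS](h A hA); apply: eq_bigr => j _; rewrite mxE.
Qed.

(** * Sums of monomials over all points *)

Lemma bits_inj m j k : (j < 2 ^ m)%N -> (k < 2 ^ m)%N ->
  (forall i, (i < m)%N -> odd (j %/ 2 ^ i) = odd (k %/ 2 ^ i)) -> j = k.
Proof.
elim: m j k => [|m IH] j k hj hk h.
  by move: hj hk; rewrite expn0 !ltnS !leqn0 => /eqP -> /eqP ->.
have h0 := h 0%N isT; rewrite expn0 !divn1 in h0.
rewrite -(odd_double_half j) -(odd_double_half k) h0; congr (_ + _.*2)%N.
apply: IH; [move: hj | move: hk |]; try (rewrite expnS; lia).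
move=> i hi; have := h i.+1 hi.
by rewrite expnS !divnMA !divn2.
Qed.

Definition bitffun m (j : 'I_(2 ^ m)) : {ffun 'I_m -> 'F_2} :=
  [ffun i => bitpoint j i].

Lemma bitffun_bij m : bijective (@bitffun m).
Proof.
apply: inj_card_bij; last by rewrite card_ffun !card_ord.
move=> j k /ffunP h; apply: val_inj.
apply: (@bits_inj m); [exact: ltn_ord | exact: ltn_ord | move=> i hi].
have hi' : (m - i.+1 < m)%N by lia.
have := h (Ordinal hi'); rewrite !ffunE /bitpoint /=.
have -> : (m - (m - i.+1).+1)%N = i by lia.
by case: (odd _); case: (odd _).
Qed.

(** Distributivity gives a product over the variables: one in [A] contributes 0 + 1 = 1, one outside
    [A] contributes 1 + 1 = 0. *)
Lemma sum_monv m (A : {set 'I_m}) :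
  \sum_(j < 2 ^ m) monv A j = (A == setT)%:R.
Proof.
rewrite (eq_bigr (fun j => \prod_i (if i \in A then bitffun j i else 1))); last first.
  by move=> j _; rewrite /monv big_mkcond; apply: eq_bigr => i _; rewrite ffunE.
rewrite -(reindex (@bitffun m) (P := xpredT)
   (F := fun f : {ffun 'I_m -> 'F_2} => \prod_i (if i \in A then f i else 1))) /=;
  last exact/onW_bij/bitffun_bij.
rewrite -(bigA_distr_bigA (fun i b => if i \in A then b else 1 : 'F_2)) /=.
have h i : \sum_(b : 'F_2) (if i \in A then b else 1) = (i \in A)%:R :> 'F_2.
  rewrite (big_ord_recl 1) (big_ord_recl 0) big_ord0.
  by case: (i \in A); apply: val_inj.
rewrite (eq_bigr _ (fun i _ => h i)).
have [->|hA] := eqVneq A setT; first by rewrite big1 // => i _; rewrite inE.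
have [i hi] : exists i, i \notin A.
  apply/existsP; apply: contraNT hA; rewrite negb_exists => /forallP hA.
  by apply/eqP/setP => i; rewrite inE; have := hA i; rewrite negbK.
by rewrite (bigD1 i) //= (negbTE hi) mul0r.
Qed.

Lemma monvM m (A B : {set 'I_m}) k : monv A k * monv B k = monv (A :|: B) k.
Proof.
rewrite /monv [X in X * _]big_mkcond [X in _ * X]big_mkcond [RHS]big_mkcond.
rewrite -big_split; apply: eq_bigr => i _ /=; rewrite inE.
by case: (i \in A); case: (i \in B); case: (odd _); rewrite /= ?mulr1 ?mul1r ?mul0r.
Qed.

(** * Restriction of monomials to the two halves of the points *)

Definition tail_set n (A : {set 'I_n.+1}) : {set 'I_n} := lift ord0 @^-1: A.

(** Variable 0 carries the top bit, which is 0 on the first half. *)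
Lemma monv_low n (A : {set 'I_n.+1}) k : (k < 2 ^ n)%N ->
  monv A k = (ord0 \notin A)%:R * monv (tail_set A) k.
Proof.
move=> hk; rewrite /monv big_mkcond big_ord_recl [in RHS]big_mkcond; congr (_ * _).
  by rewrite subSS subn0 divn_small //; case: (ord0 \in A).
by apply: eq_bigr => i _; rewrite inE lift0 subSS.
Qed.

Lemma monv_high n (A : {set 'I_n.+1}) k : (k < 2 ^ n)%N ->
  monv A (2 ^ n + k) = monv (tail_set A) k.
Proof.
move=> hk; rewrite /monv big_mkcond big_ord_recl [in RHS]big_mkcond.
rewrite -[RHS]mul1r; congr (_ * _).
  rewrite subSS subn0 divnDl // divnn expn_gt0 /= divn_small //.
  by case: (ord0 \in A).
apply: eq_bigr => i _; rewrite inE lift0 subSS.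
(* Adding [2 ^ n] changes the quotient by the even number [2 ^ i.+1], so the lower bits stay the
   same. *)
have -> : (2 ^ n = 2 ^ i.+1 * 2 ^ (n - i.+1))%N.
  by rewrite -expnD subnKC.
by rewrite divnMDl ?expn_gt0 // oddD oddX.
Qed.

Lemma tail_lift n (A : {set 'I_n}) : tail_set (lift ord0 @: A) = A.
Proof. by apply/setP => i; rewrite inE mem_imset //; apply: lift_inj. Qed.

Lemma tail_liftU n (A : {set 'I_n}) : tail_set (ord0 |: lift ord0 @: A) = A.
Proof. by rewrite -[RHS]tail_lift; apply/setP => i; rewrite !inE. Qed.

Lemma card_lift n (A : {set 'I_n}) : #|lift ord0 @: A| = #|A|.
Proof. by apply: card_imset; apply: lift_inj. Qed.

Lemma ord0_lift n (A : {set 'I_n}) : ord0 \notin lift ord0 @: A.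
Proof. by apply/imsetP => -[i _ /eqP]; rewrite (negbTE (neq_lift _ _)). Qed.

Lemma card_tail n (A : {set 'I_n.+1}) : (#|tail_set A| = #|A| - (ord0 \in A))%N.
Proof.
have hA : lift ord0 @: tail_set A = A :\ ord0.
  apply/setP => i; rewrite !inE; case: (unliftP ord0 i) => [j|] ->.
    rewrite mem_imset; last exact: lift_inj.
    by rewrite inE eq_sym neq_lift.
  by rewrite eqxx (negbTE (ord0_lift _)).
by rewrite -card_lift hA [X in (X - _)%N](cardsD1 ord0) addnC addnK.
Qed.
(* The representative of [k + dual (RM r n)] in the span of the monomials of
   degree [n - r], for [k] orthogonal to [RM (r - 1) n]. *)
Definition monrep (r n : nat) (k : 'rV['F_2]_(2 ^ n)) : 'rV['F_2]_(2 ^ n) :=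
  \sum_(B : {set 'I_n} | #|B| == (n - r)%N)
     (\sum_(j < 2 ^ n) k 0 j * monv (~: B) j) *: Evalm B.

Lemma monrep_span r n k : monrep r k \in monomial_span (n - r) n.
Proof.
apply: memv_suml => B hB; apply/memvZ/memv_span.
by apply/imageP; exists B => //; rewrite Eval_prodX.
Qed.

(** Against x_A with [#|A| <= r.+1], the term of [B] survives only if [B :|: A] is everything. By
    cardinality this forces [#|A| = r.+1] and [B = ~: A], whose coefficient is the pairing of [k]
    with x_A. For smaller [A] both pairings vanish. *)
Lemma monrep_dual r n (k : 'rV_(2 ^ n)) :
  (r < n)%N -> k \in dual (RM (Posz r) n) ->
  k - monrep r.+1 k \in dual (RM (Posz r.+1) n).
Proof.
move=> rn /dual_RM hk; apply/dual_RM => A hA.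
under eq_bigr do rewrite !mxE mulrBl.
rewrite sumrB; apply/eqP; rewrite subr_eq0; apply/eqP.
have -> : \sum_j monrep r.+1 k 0 j * monv A j =
    \sum_(B : {set 'I_n} | #|B| == (n - r.+1)%N)
      (\sum_(j < 2 ^ n) k 0 j * monv (~: B) j) * (B :|: A == setT)%:R.
  under eq_bigr do rewrite summxE mulr_suml.
  rewrite exchange_big; apply: eq_bigr => B _ /=.
  rewrite -sum_monv mulr_sumr; apply: eq_bigr => j _.
  by rewrite !mxE -mulrA monvM.
have hAB (B : {set 'I_n}) : B :|: A == setT -> (n <= #|B| + #|A|)%N.
  by move=> /eqP hBA; rewrite -[X in (X <= _)%N]card_ord -cardsT -hBA cardsU leq_subr.
move: hA; rewrite leq_eqVlt => /orP [/eqP hA | hA]; last first.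
  rewrite hk // big1 // => B /eqP hB; case: eqP => [/eqP /hAB|]; last by rewrite mulr0.
  by rewrite hB; lia.
have hcA : #|~: A| == (n - r.+1)%N by rewrite cardsCs setCK card_ord hA.
rewrite (bigD1 (~: A)) //= setCK setUC setUCr eqxx mulr1 [X in _ + X]big1 ?addr0 //.
move=> B /andP [/eqP hB hBA]; case: eqP => [hU|]; last by rewrite mulr0.
case/eqP: hBA; apply/esym/eqP; rewrite eqEcard (eqP hcA) hB leqnn andbT.
by apply/subsetP => i; rewrite inE; have := in_setT i; rewrite -hU inE; case: (i \in A); rewrite ?orbF.
Qed.

(** The coefficients are pairings with monomials of degree n - (n - r) = r, to which [k - l] is
    orthogonal. *)
Lemma monrep_eq r n (k l : 'rV_(2 ^ n)) :
  (r <= n)%N -> k - l \in dual (RM (Posz r) n) -> monrep r k = monrep r l.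
Proof.
move=> rn /dual_RM h; apply: eq_bigr => B /eqP hB; congr (_ *: _).
apply/eqP; rewrite -subr_eq0 -sumrB -[X in _ == X](h (~: B)).
  by apply/eqP/eq_bigr => j _; rewrite !mxE mulrBl.
by rewrite cardsCs setCK card_ord hB; lia.
Qed.

(** * Cosets and transversals of sets closed under subtraction *)

Section SubtractionClosed.
Variables (n : nat) (D : {set 'rV['F_2]_n}).
Hypotheses (D0 : 0 \in D) (DB : forall x y, x \in D -> y \in D -> x - y \in D).

Lemma subgrpN x : (- x \in D) = (x \in D).
Proof.
have h y : y \in D -> - y \in D by move=> hy; rewrite -[- y]add0r; apply: DB.
by apply/idP/idP => [/h|/h //]; rewrite opprK.
Qed.

Lemma subgrp_symm x y : (x - y \in D) = (y - x \in D).
Proof. by rewrite -subgrpN opprB. Qed.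

Lemma subgrpD x y : x \in D -> y \in D -> x + y \in D.
Proof. by move=> hx hy; rewrite -[y]opprK; apply: DB; rewrite ?subgrpN. Qed.

End SubtractionClosed.

Lemma mem_coset n (D : {set 'rV['F_2]_n}) u x :
  (x \in [set u + d | d in D]) = (x - u \in D).
Proof.
apply/imsetP/idP => [[d hd ->]|h]; first by rewrite addrC addKr.
by exists (x - u) => //; rewrite addrC subrK.
Qed.

Section Cosets.
Variables (n : nat) (K D : {set 'rV['F_2]_n}).
Hypotheses (D0 : 0 \in D) (DB : forall x y, x \in D -> y \in D -> x - y \in D).

Lemma transversal_coset1 U k :
  is_transversal U (cosets K D) K -> k \in K ->
  exists u, [set v in U | k - v \in D] = [set u].
Proof.
case/and3P => _ _ /forall_inP h hk.
have /cards1P [u hu] := h _ (imset_f (fun u => [set u + d | d in D]) hk).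
by exists u; rewrite -hu; apply/setP => v; rewrite !inE mem_coset (subgrp_symm D0 DB).
Qed.

Hypotheses (DK : D \subset K)
  (K0 : 0 \in K) (KB : forall x y, x \in K -> y \in K -> x - y \in K).

Lemma cosets_partition : partition (cosets K D) K.
Proof.
have -> : cosets K D = equivalence_partition (fun x y => y - x \in D) K.
  apply: eq_in_imset => u hu; apply/setP => x; rewrite mem_coset inE.
  case: (boolP (x - u \in D)) => [h|]; last by rewrite andbF.
  by rewrite andbT -[x](subrK u) (subgrpD K0 KB) // (subsetP DK).
apply: equivalence_partitionP => x y z _ _ _; split; first by rewrite subrr.
move=> hxy; apply/idP/idP => h.
  by rewrite -(subrK x z) -addrA (subgrpD D0 DB) // (subgrp_symm D0 DB).
by rewrite -(subrK y z) -addrA (subgrpD D0 DB).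
Qed.

(** Here [f] is a normal form: it stays in the coset and depends only on it, so its values meet each
    coset once. *)
Lemma transversal_imset (f : 'rV['F_2]_n -> 'rV['F_2]_n) :
  (forall k, k \in K -> k - f k \in D) ->
  (forall k l, k - l \in D -> f k = f l) ->
  is_transversal (f @: K) (cosets K D) K.
Proof.
move=> fD fE; apply/and3P; split; first exact: cosets_partition.
  apply/subsetP => _ /imsetP [k hk ->].
  by rewrite -[f k](subKr k) KB // (subsetP DK) // fD.
apply/forall_inP => _ /imsetP [k hk ->]; apply/cards1P; exists (f k).
apply/setP => x; rewrite in_set1 inE mem_coset; apply/andP/eqP => [[] | ->].
  case/imsetP => l hl -> h; apply: fE; rewrite -(subrK (f l) l) -addrA.
  by apply: (subgrpD D0 DB) => //; apply: fD.
by rewrite imset_f // (subgrp_symm D0 DB) fD.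
Qed.

End Cosets.

(** * Splitting punctured codes and their duals into halves *)

Lemma sum_cast_row n1 n2 n (e : (n1 + n2)%N = n) (x1 : 'rV['F_2]_n1)
    (x2 : 'rV['F_2]_n2) (F : nat -> 'F_2) :
  \sum_(j < n) cast_vec e (row_mx x1 x2) 0 j * F j =
  \sum_(j < n1) x1 0 j * F j + \sum_(j < n2) x2 0 j * F (n1 + j)%N.
Proof.
case: _ / e; rewrite /cast_vec castmx_id big_split_ord /=; congr (_ + _);
  by apply: eq_bigr => j _; rewrite ?row_mxEl ?row_mxEr.
Qed.

(** A monomial containing variable 0 tests only [x2], with degree lowered by one; any other
    restricts to the same monomial on both halves. *)
Lemma dual_pRM_split r n (e : ((2 ^ n).-1 + 2 ^ n)%N = (2 ^ n.+1).-1) x1 x2 :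
  (cast_vec e (row_mx x1 x2) \in dual (pRM (Posz r.+1) n.+1)) <->
  x2 \in dual (RM (Posz r) n) /\
  forall A : {set 'I_n}, (#|A| <= r.+1)%N ->
    \sum_(j < (2 ^ n).-1) x1 0 j * monv A j.+1 + \sum_(j < 2 ^ n) x2 0 j * monv A j = 0.
Proof.
have hlow j : (j < (2 ^ n).-1)%N -> (j.+1 < 2 ^ n)%N by lia.
have split_sum (A : {set 'I_n.+1}) :
    \sum_(j < (2 ^ n.+1).-1) cast_vec e (row_mx x1 x2) 0 j * monv A j.+1 =
    (ord0 \notin A)%:R * (\sum_(j < (2 ^ n).-1) x1 0 j * monv (tail_set A) j.+1) +
    \sum_(j < 2 ^ n) x2 0 j * monv (tail_set A) j.
  rewrite (sum_cast_row e x1 x2 (fun j => monv A j.+1)) mulr_sumr; congr (_ + _).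
    by apply: eq_bigr => j _; rewrite monv_low ?hlow // mulrCA.
  (* Entry [(2 ^ n).-1 + j] of the punctured vector belongs to the point [2 ^ n + j]. *)
  apply: eq_bigr => j _; rewrite -addSn prednK ?exp2_gt0 //.
  by rewrite monv_high.
split=> [/dual_pRM h | [/dual_RM h2 h]].
  split=> [|A hA].
    apply/dual_RM => A hA; have := h (ord0 |: lift ord0 @: A).
    rewrite split_sum tail_liftU setU11 mul0r add0r; apply.
    by rewrite cardsU1 ord0_lift card_lift.
  have := h (lift ord0 @: A); rewrite split_sum tail_lift ord0_lift mul1r; apply.
  by rewrite card_lift.
apply/dual_pRM => A hA; rewrite split_sum; have := card_tail A.
case: (boolP (ord0 \in A)) => hA0 hc.
  by rewrite mul0r add0r h2 // hc; move: hA; lia.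
by rewrite mul1r h // hc; move: hA; lia.
Qed.

Lemma sum_puncture n (u : 'rV_(2 ^ n)) (F : nat -> 'F_2) :
  u 0 (Ordinal (exp2_gt0 n)) = 0 ->
  \sum_(j < (2 ^ n).-1) puncture u 0 j * F j.+1 = \sum_(j < 2 ^ n) u 0 j * F j.
Proof.
move=> hu; rewrite (bigD1_ord (Ordinal (exp2_gt0 n))) //= hu mul0r add0r.
by apply: eq_bigr => j _; rewrite mxE.
Qed.

(** Fixing the first variable does not raise the degree: a monomial restricts to zero or to the one
    given by [tail_set]. *)
Lemma pRM_split r n (e : ((2 ^ n).-1 + 2 ^ n)%N = (2 ^ n.+1).-1) w1 w2 :
  cast_vec e (row_mx w1 w2) \in pRM (Posz r) n.+1 ->
  w1 \in pRM (Posz r) n /\ w2 \in RM (Posz r) n.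
Proof.
case/imsetP => c hc hw.
have hlo (j : 'I_(2 ^ n)) : (j < 2 ^ n.+1)%N.
  by have := ltn_ord j; rewrite expnS; lia.
have hhi (j : 'I_(2 ^ n)) : (2 ^ n + j < 2 ^ n.+1)%N.
  by have := ltn_ord j; rewrite expnS; lia.
pose c1 := \row_j c 0 (Ordinal (hlo j)).
pose c2 := \row_j c 0 (Ordinal (hhi j)).
have [hc1 hc2] : c1 \in RM (Posz r) n /\ c2 \in RM (Posz r) n.
  rewrite /c1 /c2; move: c hc {hw c1 c2}; apply: RM_ind => [|x y [x1 x2] [y1 y2]|A hA].
  - by split; rewrite (_ : \row_j _ = 0) ?RM0 //; apply/rowP => j; rewrite !mxE.
  - split.
      rewrite (_ : \row_j _ = \row_j x 0 (Ordinal (hlo j)) + \row_j y 0 (Ordinal (hlo j))).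
        exact: RMD.
      by apply/rowP => j; rewrite !mxE.
    rewrite (_ : \row_j _ = \row_j x 0 (Ordinal (hhi j)) + \row_j y 0 (Ordinal (hhi j))).
      exact: RMD.
    by apply/rowP => j; rewrite !mxE.
  have hT : (#|tail_set A| <= r)%N.
    by rewrite card_tail; apply: leq_trans hA; apply: leq_subr.
  split.
    case: (boolP (ord0 \in A)) => h0.
      rewrite (_ : \row_j _ = 0); first exact: RM0.
      by apply/rowP => j; rewrite !mxE monv_low //= h0 mul0r.
    rewrite (_ : \row_j _ = Evalm (tail_set A)); first exact: RM_Evalm.
    by apply/rowP => j; rewrite !mxE monv_low //= h0 mul1r.
  rewrite (_ : \row_j _ = Evalm (tail_set A)); first exact: RM_Evalm.
  by apply/rowP => j; rewrite !mxE monv_high.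
have hwE (i : 'I_(2 ^ n.+1).-1) (j : 'I_((2 ^ n).-1 + 2 ^ n)) : (i : nat) = j -> cast_vec e (row_mx w1 w2) 0 i = row_mx w1 w2 0 j.
  move=> hij; rewrite castmxE /= cast_ord_id; congr (row_mx _ _ _ _).
  exact: val_inj.
have cE (i : 'I_(2 ^ n.+1).-1) (k : 'I_(2 ^ n.+1)) : i.+1 = k ->
    puncture c 0 i = c 0 k.
  by move=> hik; rewrite mxE; congr (c _ _); apply: val_inj.
split.
  apply/imsetP; exists c1 => //; apply/rowP => j; rewrite !mxE.
  rewrite -(cE (cast_ord e (lshift _ j))) // -hw.
  by rewrite (hwE _ (lshift _ j)) // row_mxEl.
suff -> : w2 = c2 by [].
apply/rowP => j; rewrite !mxE -(cE (cast_ord e (rshift _ j))) /=.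
  by rewrite -hw (hwE _ (rshift _ j)) // row_mxEr.
by rewrite -addSn prednK ?exp2_gt0.
Qed.

(** * Amplitudes of coset states *)

Lemma coset_stateE (C : numClosedFieldType) n (D : {set 'rV['F_2]_n}) w y :
  (coset_state C D w y : C) = (sqrtC (#|D|%:R : C))^-1 * (y - w \in D)%:R.
Proof.
rewrite ffunE sum_ffunE; congr (_ * _).
under eq_bigr do rewrite ffunE.
case: (boolP (y - w \in D)) => h.
  rewrite (bigD1 (y - w)) //= [w + _]addrC subrK eqxx big1 ?addr0 // => c /andP [_ hc].
  by rewrite addrC -subr_eq eq_sym (negbTE hc).
rewrite big1 // => c hc; case: eqP => // hy; case/negP: h.
by rewrite hy addrC addKr.
Qed.

(** The sum counts the products of translates of [D1] and [D2] containing a point, so the hypothesis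
    says that [D] is their disjoint union. This yields the normalization, through
    [#|D| = #|U| * (#|D1| * #|D2|)], as well as the amplitudes. *)
Lemma coset_state_split (C : numClosedFieldType) n1 n2 n (e : (n1 + n2)%N = n)
    (I : finType) (U : {set I}) (f1 : I -> 'rV['F_2]_n1) (f2 : I -> 'rV['F_2]_n2)
    (D : {set 'rV['F_2]_n}) (D1 : {set 'rV['F_2]_n1}) (D2 : {set 'rV['F_2]_n2}) w1 w2 :
  (forall x1 x2, nat_of_bool (cast_vec e (row_mx x1 x2) \in D) =
     \sum_(u in U) ((x1 - f1 u)%R \in D1) && ((x2 - f2 u)%R \in D2))%N ->
  coset_state C D (cast_vec e (row_mx w1 w2)) =
  cast_state e ((sqrtC (#|U|%:R : C))^-1 *:
    \sum_(u in U) tensor (coset_state C D1 (w1 + f1 u)) (coset_state C D2 (w2 + f2 u))).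
Proof.
case: _ / e D => D hD.
have sum_mem (T : finType) (X : {set T}) : (\sum_x (x \in X) = #|X|)%N.
  by rewrite -sum1_card [RHS]big_mkcond; apply: eq_bigr => x _; case: (x \in X).
have sum_memB k (E : {set 'rV['F_2]_k}) y : (\sum_x ((x - y)%R \in E) = #|E|)%N.
  rewrite -sum_mem [LHS](reindex (fun x => x + y)) /=.
    by apply: eq_bigr => x _; rewrite addrK.
  by apply: onW_bij; exists (fun x => x - y) => x; rewrite ?addrK ?subrK.
have cardD : #|D| = (#|U| * (#|D1| * #|D2|))%N.
  rewrite -sum_mem (reindex (fun p : 'rV['F_2]_n1 * 'rV['F_2]_n2 => row_mx p.1 p.2)) /=;
    last first.
    apply: onW_bij; exists (fun x => (lsubmx x, rsubmx x)).
      by move=> [x y] /=; rewrite row_mxKl row_mxKr.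
    by move=> x; rewrite hsubmxK.
  under eq_bigr => p _ do rewrite -[row_mx _ _](castmx_id (erefl, erefl)) hD.
  rewrite exchange_big /= -sum_nat_const; apply: eq_bigr => u _.
  rewrite -(sum_memB _ D1 (f1 u)) -(sum_memB _ D2 (f2 u)) big_distrlr pair_bigA /=.
  by apply: eq_bigr => p _; rewrite mulnb.
apply/ffunP => y; rewrite coset_stateE !ffunE sum_ffunE /cast_vec !castmx_id.
under [in RHS]eq_bigr do rewrite ffunE !coset_stateE mulrACA -natrM mulnb.
rewrite -mulr_sumr -natr_sum.
(* The amplitude at [y] is governed by the difference of [y] and the codeword, so the decomposition
   is read off at that difference. *)
have := hD (lsubmx y - w1) (rsubmx y - w2).
rewrite /cast_vec castmx_id -add_row_mx -opp_row_mx hsubmxK => ->.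
rewrite cardD !natrM !sqrtCM ?nnegrE ?mulr_ge0 ?ler0n // !invfM.
rewrite -!mulrA; congr (_ * (_ * (_ * _%:R))).
by apply: eq_bigr => u _; rewrite !opprD !addrA.
Qed.

Theorem theorem2 (C : numClosedFieldType) (m r : nat)
    (hm : (1 <= m)%N) (hr : (r < m.-1)%N) (hr' : (uphalf m.-1 <= r)%N) :
  let K := dual (RM (r%:Z - 1) m.-1) in
  let D := dual (RM r m.-1) in
  let B := cosets K D in
  let V := monomial_span (m - r - 1) m.-1 in
  (exists2 U : {set 'rV['F_2]_(2 ^ m.-1)},
     is_transversal U B K & {subset U <= V}) /\
  forall (U : {set 'rV['F_2]_(2 ^ m.-1)}),
    is_transversal U B K -> {subset U <= V} ->
  forall (w1 : 'rV['F_2]_((2 ^ m.-1).-1)) (w2 : 'rV['F_2]_(2 ^ m.-1)),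
    let w := cast_vec (split_length hm) (row_mx w1 w2) in
    w \in pRM r m ->
  [/\ w1 \in pRM r m.-1,
      w2 \in RM r m.-1,
      forall u, u \in U ->
        pQRM_state C r (w1 + puncture u) \in pQRM C r m.-1 /\
        QRM_state C r (w2 + u) \in QRM C r m.-1
    & pQRM_state C r w =
      cast_state (split_length hm)
        ((sqrtC (#|B|%:R : C))^-1 *:
         \sum_(u in U) tensor (pQRM_state C r (w1 + puncture u))
                              (QRM_state C r (w2 + u)))].
Proof.
case: m hm hr hr' => [//|n] hm; rewrite [n.+1.-1]/=.
(* A zero [r] would force [n = 0], against [r < n]. With [r.+1] in place of [r], the order [r - 1]
   is a natural number. *)
case: r => [|r] hr hr'; first by exfalso; move: hr hr'; lia.
have -> : (n.+1 - r.+1 - 1 = n - r.+1)%N by lia.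
have -> : r.+1%:Z - 1 = Posz r by lia.
move=> K D B V.
have DK : D \subset K by apply/dualS/subsetP/RM_mono.
have D0 : 0 \in D by apply: dual0.
have K0 : 0 \in K by apply: dual0.
have DB : forall x y, x \in D -> y \in D -> x - y \in D by move=> x y; apply: dualB.
have KB : forall x y, x \in K -> y \in K -> x - y \in K by move=> x y; apply: dualB.
split.
  exists (@monrep r.+1 n @: K).
    apply: transversal_imset => // [k|k l]; first exact: (monrep_dual (ltnW hr)).
    exact: (monrep_eq (ltnW hr)).
  by move=> _ /imsetP [k _ ->]; apply: monrep_span.
move=> U hU UV w1 w2 w hw.
have [hw1 hw2] := pRM_split hw.
(* The degree [n - r.+1] is at most [r.+1] because [uphalf n <= r.+1], and positive because
   [r.+1 < n]; positivity makes the monomials vanish at the origin. *)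
have hUV u : u \in U -> u \in RM (Posz r.+1) n /\ u 0 (Ordinal (exp2_gt0 n)) = 0.
  move=> /UV; move: u; apply: span_ind => [|a x y [hx x0] [hy y0]|x].
  - by rewrite mxE; split=> //; apply: RM0.
  - case: (F2_cases a) => ->; first by rewrite scale0r add0r.
    by rewrite scale1r mxE x0 y0 addr0; split=> //; apply: RMD.
  case/imageP => A; rewrite inE => /eqP hA ->; rewrite Eval_prodX; split.
    by apply: RM_Evalm; rewrite hA; move: hr'; lia.
  have /card_gt0P [i hi] : (0 < #|A|)%N by rewrite hA; lia.
  by rewrite mxE /monv (bigD1 i) //= div0n mul0r.
split=> // [u hu|].
  have [huR _] := hUV u hu; split; apply/memv_span.
    apply/imageP; exists (w1 + puncture u) => //.
    case/imsetP: hw1 => c hc ->; apply/imsetP; exists (c + u); first exact: RMD.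
    by apply/rowP => j; rewrite !mxE.
  by apply/imageP; exists (w2 + u) => //; apply: RMD.
have <- : #|U| = #|B| by apply: card_transversal hU.
apply: coset_state_split => x1 x2.
(* Subtracting [puncture u] adds its pairing, in characteristic 2. That pairing equals the one of
   [u], which is 0 at the origin, hence the one of [x2], as [x2 - u] lies in [D]. *)
have key u (A : {set 'I_n}) : u \in U -> x2 - u \in D -> (#|A| <= r.+1)%N ->
    \sum_(j < (2 ^ n).-1) (x1 - puncture u) 0 j * monv A j.+1 =
    \sum_(j < (2 ^ n).-1) x1 0 j * monv A j.+1 + \sum_(j < 2 ^ n) x2 0 j * monv A j.
  move=> hu /dual_RM h hA; have [_ u0] := hUV u hu.
  under eq_bigr do rewrite !mxE mulrDl F2_opp.
  rewrite big_split /=; congr (_ + _).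
  transitivity (\sum_(j < (2 ^ n).-1) puncture u 0 j * monv A j.+1).
    by apply: eq_bigr => j _; rewrite mxE.
  rewrite (sum_puncture (monv A) u0); apply/esym/eqP; rewrite -subr_eq0 -sumrB.
  rewrite -[X in _ == X](h _ hA); apply/eqP/eq_bigr => j _.
  by rewrite !mxE mulrBl.
have UK u : u \in U -> u \in K by case/and3P: hU => _ /subsetP h _; apply: h.
have hxK u : u \in U -> x2 - u \in D -> x2 \in K.
  move=> hu h2; rewrite -[x2](subrK u).
  exact: (subgrpD K0 KB (subsetP DK _ h2) (UK _ hu)).
have hmem : (cast_vec (split_length hm) (row_mx x1 x2) \in dual (pRM (Posz r.+1) n.+1)) <->
   exists2 u, u \in U & (x1 - puncture u \in dual (pRM (Posz r.+1) n)) && (x2 - u \in D).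
  split=> [/dual_pRM_split [h2 h]|[u hu /andP [/dual_pRM h1 h2]]].
    have [u /setP hu1] := transversal_coset1 D0 DB hU h2.
    have := hu1 u; rewrite inE set11 => /andP [hu hd]; exists u => //.
    rewrite hd andbT; apply/dual_pRM => A hA.
    by rewrite (key u) // h.
  apply/dual_pRM_split; split=> [|A hA]; first exact: (hxK u).
  by rewrite -(key u) // h1.
(* Existence becomes a count: the representative of the coset of [x2] is unique, so at most one term
   is 1. *)
apply/esym; case: (boolP (_ \in _)) => [/hmem [u hu hxu]|hx]; last first.
  rewrite big1 // => u hu; case: (boolP (_ && _)) => // h.
  by case/negP: hx; apply/hmem; exists u.
rewrite (bigD1 u) //= hxu big1 // => v /andP [hv vu].
case: (boolP (_ && _)) => // /andP [_ hxv].
have [t /setP ht] := transversal_coset1 D0 DB hU (hxK _ hv hxv).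
have eqt x : x \in U -> x2 - x \in D -> x = t.
  by move=> hx hxD; apply/set1P; rewrite -ht inE hx.
by case/andP: hxu => _ /(eqt _ hu) ut; rewrite ut (eqt _ hv hxv) eqxx in vu.
Qed.
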